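(* Let $n\ge 2$, let $p$ be a prime with $p\geq n$, and let $\rho:M_n\to GL_{p^N}(\mathbb{C})$ be a $p^N$-dimensional representation of $M_n$ in standard form, with associated numbers $\lambda_1,\dots,\lambda_n$. Then $\rho$ is irreducible if and only if there exists $i$ with $2\le i\le n$ such that $s(\lambda_i)=N$.
   Context: $M_n=\langle a_1,\dots,a_n,b \mid [a_i,b]=a_{i+1}\ (1\le i\le n-1)\rangle$, where all commutators of generators that do not appear in the relations are trivial, and $[g,h]=ghg^{-1}h^{-1}$. Define $T_0(j)=1$ for $j\ge 0$, $T_k(0)=0$ for $k\ge1$, and $T_k(j)=\sum_{l=1}^{j}T_{k-1}(l)$ for $k,j\ge 1$ (so $T_k(j)=\binom{j+k-1}{k}$ for $j\ge1$). For a representation $\rho:M_n\to GL_{p^N}(\mathbb{C})$ put $x_i=\rho(a_i)$, $y=\rho(b)$. With respect to the basis $e_1,\dots,e_{p^N}$, $\rho$ is in standard form if $y$ is the $p^N$-cycle permutation matrix given by $ye_j=e_{j+1}$ for $j<p^N$ and $ye_{p^N}=e_1$, and every $x_i$ is diagonal such that, writing $\lambda_{i,j}$ for the $j$th diagonal entry of $x_i$ and $\lambda_i=\lambda_{i,1}$, one has $\lambda_1=1$ and $\lambda_{i,j}=\prod_{k=i}^{n}\lambda_k^{T_{k-i}(j-1)}$ for all $1\le i\le n$, $1\le j\le p^N$ (in particular $x_n=\lambda_n I$). $S_p^k$ is the set of complex $p^k$th roots of unity. The depth of a complex $p$-power root of unity $\lambda$ is $s(\lambda)=k$ where $\lambda\in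 S_p^k\setminus S_p^{k-1}$ (and $s(1)=0$); i.e. $\lambda$ is a primitive $p^{s(\lambda)}$th root of unity. *)

(* Defs.v *)
From HB Require Import structures.
From mathcomp Require Import all_boot all_order all_algebra.
From mathcomp Require Import boolp reals complex.

Set Implicit Arguments.
Unset Strict Implicit.
Unset Printing Implicit Defensive.

Import GRing.Theory.
Local Open Scope ring_scope.
Local Open Scope quotient_scope.

(* Groups given by generators and relations.  A letter (x, false) stands for
   the generator x and (x, true) for its formal inverse. *)
Notation word X := (seq (X * bool)).

Definition gen_word (X : Type) (x : X) : word X := [:: (x, false)].

Definition inv_word (X : Type) (u : word X) : word X :=
  rev [seq (l.1, ~~ l.2) | l <- u].

(* The commutator convention is [g, h] = g h g^-1 h^-1; MathComp's
   [~ g, h] is g^-1 h^-1 g h. *)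
Definition comm_word (X : Type) (u v : word X) : word X :=
  u ++ v ++ inv_word u ++ inv_word v.

Inductive word_eqv (X : Type) (rels : word X -> word X -> Prop) :
    word X -> word X -> Prop :=
| weqv_refl u : word_eqv rels u u
| weqv_sym u v : word_eqv rels u v -> word_eqv rels v u
| weqv_trans v u w : word_eqv rels u v -> word_eqv rels v w -> word_eqv rels u w
| weqv_cat u v u' v' :
    word_eqv rels u u' -> word_eqv rels v v' -> word_eqv rels (u ++ v) (u' ++ v')
| weqv_cancel x e : word_eqv rels [:: (x, e); (x, ~~ e)] [::]
| weqv_rel u v : rels u v -> word_eqv rels u v.

Section Presented.
Variables (X : choiceType) (rels : word X -> word X -> Prop).

Definition word_eqvb (u v : word X) : bool := `[< word_eqv rels u v >].

Lemma word_eqvb_equiv : equiv_class_of word_eqvb.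
Proof.
split=> [u|u v|v u w].
- exact/asboolP/weqv_refl.
- by apply/asboolP/asboolP; exact: weqv_sym.
- by move=> /asboolP uv /asboolP vw; apply/asboolP/(weqv_trans uv vw).
Qed.

Canonical word_eqvb_equiv_rel := EquivRelPack word_eqvb_equiv.

(* The group < X | u = v for all u, v with rels u v >. *)
Definition presented : Type := {eq_quot word_eqvb}.
HB.instance Definition _ := Choice.on presented.
HB.instance Definition _ : EqQuotient _ word_eqvb presented :=
  EqQuotient.on presented.

Definition word_class (u : word X) : presented := \pi_presented u.

Lemma word_classP (u v : word X) :
  word_class u = word_class v <-> word_eqv rels u v.
Proof.
rewrite /word_class; split=> [/eqP|uv]; last apply/eqP.
  by rewrite piE => /asboolP.
by rewrite piE; exact/asboolP.
Qed.

Lemma word_classK : cancel (@repr _ presented) word_class.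
Proof. exact: reprK. Qed.

Lemma word_class_surj (g : presented) : exists u, g = word_class u.
Proof. by exists (repr g); rewrite word_classK. Qed.

Lemma repr_word_class (u : word X) : word_eqv rels (repr (word_class u)) u.
Proof. by apply/word_classP; rewrite word_classK. Qed.

Lemma inv_word_cat (u v : word X) :
  inv_word (u ++ v) = inv_word v ++ inv_word u.
Proof. by rewrite /inv_word map_cat rev_cat. Qed.

Lemma inv_wordK : involutive (@inv_word X).
Proof.
move=> u; rewrite /inv_word map_rev revK -map_comp map_id_in //.
by move=> [x e] _ /=; rewrite negbK.
Qed.

Lemma mul_inv_word (u : word X) : word_eqv rels (u ++ inv_word u) [::].
Proof.
elim/last_ind: u => [|u [x e] IHu]; first exact: weqv_refl.
rewrite -cats1 inv_word_cat -catA; apply: weqv_trans IHu.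
apply: weqv_cat; first exact: weqv_refl.
rewrite catA -[inv_word u in X in word_eqv _ _ X]cat0s.
by apply: weqv_cat; [exact: weqv_cancel | exact: weqv_refl].
Qed.

Lemma inv_word_mul (u : word X) : word_eqv rels (inv_word u ++ u) [::].
Proof. by rewrite -[u in X in _ ++ X]inv_wordK; exact: mul_inv_word. Qed.

Lemma inv_word_eqv (u v : word X) :
  word_eqv rels u v -> word_eqv rels (inv_word u) (inv_word v).
Proof.
move=> uv; apply: (@weqv_trans _ _ (inv_word u ++ v ++ inv_word v)).
  rewrite -[inv_word u in X in word_eqv _ X]cats0; apply: weqv_cat.
    exact: weqv_refl.
  exact/weqv_sym/mul_inv_word.
rewrite catA -[inv_word v in X in word_eqv _ _ X]cat0s.
apply: weqv_cat (weqv_refl _ _); apply: weqv_trans (inv_word_mul u).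
by apply: weqv_cat; [exact: weqv_refl | exact: weqv_sym].
Qed.

Definition presented_one : presented := word_class [::].
Definition presented_mul (g h : presented) : presented :=
  word_class (repr g ++ repr h).
Definition presented_inv (g : presented) : presented :=
  word_class (inv_word (repr g)).

Lemma presented_mulE (u v : word X) :
  presented_mul (word_class u) (word_class v) = word_class (u ++ v).
Proof. by apply/word_classP/weqv_cat; exact: repr_word_class. Qed.

Lemma presented_invE (u : word X) :
  presented_inv (word_class u) = word_class (inv_word u).
Proof. by apply/word_classP/inv_word_eqv/repr_word_class. Qed.

Lemma presented_mulA : associative presented_mul.
Proof.
move=> f g h; have [u ->] := word_class_surj f.
have [v ->] := word_class_surj g; have [w ->] := word_class_surj h.
by rewrite !presented_mulE catA.
Qed.

Lemma presented_mul1g : left_id presented_one presented_mul.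
Proof. by move=> g; have [u ->] := word_class_surj g; rewrite presented_mulE. Qed.

Lemma presented_mulg1 : right_id presented_one presented_mul.
Proof.
by move=> g; have [u ->] := word_class_surj g; rewrite presented_mulE cats0.
Qed.

Lemma presented_mulVg :
  left_inverse presented_one presented_inv presented_mul.
Proof.
move=> g; have [u ->] := word_class_surj g.
by rewrite presented_invE presented_mulE; apply/word_classP/inv_word_mul.
Qed.

Lemma presented_mulgV :
  right_inverse presented_one presented_inv presented_mul.
Proof.
move=> g; have [u ->] := word_class_surj g.
by rewrite presented_invE presented_mulE; apply/word_classP/mul_inv_word.
Qed.

HB.instance Definition _ := isGroup.Build presented
  presented_mulA presented_mul1g presented_mulg1
  presented_mulVg presented_mulgV.

Definition presented_gen (x : X) : presented := word_class (gen_word x).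

Lemma word_class_nil : word_class [::] = 1%g.
Proof. by []. Qed.

Lemma word_class_cat (u v : word X) :
  word_class (u ++ v) = (word_class u * word_class v)%g.
Proof. exact/esym/presented_mulE. Qed.

Lemma word_class_inv (u : word X) :
  word_class (inv_word u) = ((word_class u)^-1)%g.
Proof. exact/esym/presented_invE. Qed.

Lemma word_class_comm (u v : word X) :
  word_class (comm_word u v) =
  (word_class u * word_class v * (word_class u)^-1 * (word_class v)^-1)%g.
Proof. by rewrite /comm_word !word_class_cat !word_class_inv !mulgA. Qed.

Definition eval_word (H : groupType) (f : X -> H) (u : word X) : H :=
  (\prod_(l <- u) if l.2 then (f l.1)^-1 else f l.1)%g.

Lemma presented_lift (H : groupType) (f : X -> H) :
  (forall u v, rels u v -> eval_word f u = eval_word f v) ->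
  exists2 phi : presented -> H,
    {morph phi : g h / (g * h)%g} & forall x, phi (presented_gen x) = f x.
Proof.
move=> fP; have fE u v : word_eqv rels u v -> eval_word f u = eval_word f v.
  elim=> {u v} [//|//|v u w _ -> _ -> //|u v u' v' _ uu' _ vv'|x e|u v /fP //].
    by rewrite /eval_word !big_cat /= -!/(eval_word f _) uu' vv'.
  by rewrite /eval_word !big_cons big_nil mulg1 /=; case: e;
    rewrite /= ?mulVg ?mulgV.
exists (fun g => eval_word f (repr g)) => [g h|x].
  rewrite -[g]word_classK -[h]word_classK -word_class_cat.
  rewrite !(fE _ _ (repr_word_class _)).
  by rewrite /eval_word big_cat.
rewrite (fE _ _ (repr_word_class _)).
by rewrite /eval_word big_cons big_nil mulg1.
Qed.

End Presented.

(* Generators of M_n: [Some i] is a_(i+1) (0 <= i < n) and [None] is b. *)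
Notation M_index n := (option 'I_n).

Inductive M_rel (n : nat) : word (M_index n) -> word (M_index n) -> Prop :=
| M_rel_next (i j : 'I_n) : j = i.+1 :> nat ->
    M_rel (comm_word (gen_word (Some i)) (gen_word None)) (gen_word (Some j))
| M_rel_last (i : 'I_n) : i.+1 = n ->
    M_rel (comm_word (gen_word (Some i)) (gen_word None)) [::]
| M_rel_aa (i j : 'I_n) :
    M_rel (comm_word (gen_word (Some i)) (gen_word (Some j))) [::].

Definition M (n : nat) : Type := presented (@M_rel n).
HB.instance Definition _ (n : nat) := Group.on (M n).

Definition M_a (n : nat) (i : 'I_n) : M n := presented_gen (@M_rel n) (Some i).
Definition M_b (n : nat) : M n := presented_gen (@M_rel n) None.

Section MRelations.
Local Open Scope group_scope.
Variable n : nat.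

Lemma M_a_b_next (i j : 'I_n) : j = i.+1 :> nat ->
  M_a i * M_b n * (M_a i)^-1 * (M_b n)^-1 = M_a j.
Proof.
move=> ij; apply: etrans (esym (word_class_comm _ _ _)) _.
by apply/word_classP/weqv_rel; exact: M_rel_next.
Qed.

Lemma M_a_b_last (i : 'I_n) : i.+1 = n ->
  M_a i * M_b n * (M_a i)^-1 * (M_b n)^-1 = 1.
Proof.
move=> ij; apply: etrans (esym (word_class_comm _ _ _)) _.
by apply/word_classP/weqv_rel; exact: M_rel_last.
Qed.

Lemma M_a_a (i j : 'I_n) :
  M_a i * M_a j * (M_a i)^-1 * (M_a j)^-1 = 1.
Proof.
apply: etrans (esym (word_class_comm _ _ _)) _.
by apply/word_classP/weqv_rel; exact: M_rel_aa.
Qed.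

End MRelations.

(* Representations on column vectors: g acts by v |-> rho g *m v. *)
Record representation (G : groupType) (F : fieldType) (d : nat) :=
  Representation {
    repr_mx :> G -> 'M[F]_d;
    repr_mx1 : repr_mx 1%g = 1%:M;
    repr_mxM : forall g h, repr_mx (g * h)%g = repr_mx g *m repr_mx h
  }.

(* The image therefore lies in GL_d(F). *)
Lemma repr_mx_unit (G : groupType) (F : fieldType) (d : nat)
  (rho : representation G F d) (g : G) : rho g \in unitmx.
Proof.
have: rho g *m rho (g^-1)%g = 1%:M by rewrite -repr_mxM mulgV repr_mx1.
by move/mulmx1_unit => [].
Qed.

Definition stable_subspace (G : groupType) (F : fieldType) (d : nat)
    (rho : representation G F d) (U : {vspace 'cV[F]_d}) : Prop :=
  forall (g : G) (v : 'cV[F]_d), v \in U -> rho g *m v \in U.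

Definition irreducible_repr (G : groupType) (F : fieldType) (d : nat)
    (rho : representation G F d) : Prop :=
  (0 < d)%N /\
  forall U : {vspace 'cV[F]_d}, stable_subspace rho U -> U = 0%VS \/ U = fullv.

(* T_k(j) *)
Fixpoint iter_sum (k j : nat) : nat :=
  if k is k'.+1 then (\sum_(1 <= l < j.+1) iter_sum k' l)%N else 1%N.

(* Indices are 0-based: [lam i] is lambda_(i+1), and for j : 'I_d the diagonal
   entry [rho (M_a i) j j] is lambda_(i+1, j+1), so that the second argument of
   iter_sum, "position minus one", is j itself.  [ordS] is the cyclic successor. *)
Definition standard_form (n d : nat) (F : fieldType)
    (rho : representation (M n) F d) (lam : 'I_n -> F) : Prop :=
  [/\ forall j : 'I_d,
        rho (M_b n) *m delta_mx j 0 = delta_mx (ordS j) 0 :> 'cV[F]_d,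
      forall i : 'I_n, is_diag_mx (rho (M_a i)),
      forall (i : 'I_n) (j : 'I_d), j = 0%N :> nat -> lam i = rho (M_a i) j j,
      forall i : 'I_n, i = 0%N :> nat -> lam i = 1 &
      forall (i : 'I_n) (j : 'I_d),
        rho (M_a i) j j = \prod_(k < n | (i <= k)%N) lam k ^+ iter_sum (k - i) j].

(* Membership in S_p^k. *)
Definition ppower_root (F : fieldType) (p k : nat) (z : F) : bool :=
  z ^+ (p ^ k) == 1.

(* s(z) = k, as a relation: the depth is only defined on p-power roots of
   unity.  For k = 0 the second clause is void, giving s(z) = 0 iff z = 1. *)
Definition has_depth (F : fieldType) (p : nat) (z : F) (k : nat) : Prop :=
  ppower_root p k z /\ forall k' : nat, k = k'.+1 -> ~~ ppower_root p k' z.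

(* Main.v *)
Require Import Defs.
From mathcomp Require Import all_boot all_order all_algebra.
From mathcomp Require Import reals complex.
Local Open Scope ring_scope.

(** Call the j-th weight the tuple of eigenvalues of x_1, ..., x_n on e_j.  The
    relations x_i y = x_(i+1) y x_i make each weight determine the next one and
    the previous one, so the weights form a periodic sequence, and rho is
    irreducible iff p^N is its least period: if the weights are distinct, an
    invariant subspace is spanned by basis vectors, which y permutes
    transitively; if r < p^N is a period, y^r is a non-scalar intertwiner.
    Since k T_k(r) is a multiple of r and k < p for every T_k that occurs, a
    p-power dividing r divides T_k(r) for k >= 1.  Solving the period equations
    from i = n downwards, r is a period iff lambda_i^g = 1 for all i >= 2, with
    g = gcd(r, p^N). *)

Set Implicit Arguments.
Unset Strict Implicit.
Unset Printing Implicit Defensive.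

Import GRing.Theory.

(** * Binomial form and divisibility of the iterated sums T_k *)

Lemma iter_sumS k j :
  iter_sum k.+1 j.+1 = (iter_sum k.+1 j + iter_sum k j.+1)%N.
Proof. by rewrite /= big_nat_recr. Qed.

Lemma iter_sum_0r k : iter_sum k.+1 0 = 0%N.
Proof. by rewrite /= big_geq. Qed.

Lemma iter_sum1n j : iter_sum 1 j = j.
Proof. by rewrite /= sum_nat_const_nat muln1 subn1. Qed.

Lemma iter_sum_bin k j : iter_sum k j.+1 = 'C(j + k, k).
Proof.
elim: k j => [|k IHk] j; first by rewrite bin0.
elim: j => [|j IHj].
  by rewrite iter_sumS iter_sum_0r IHk !add0n !binn.
by rewrite iter_sumS IHj IHk !addSn !addnS [RHS]binS.
Qed.

(** For r = j + 1 this is the absorption identity (k+1) C(j+k+1, k+1) = (j+1) C(j+k+1, k). *)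
Lemma dvdn_mul_iter_sum k r : (r %| k.+1 * iter_sum k.+1 r)%N.
Proof.
case: r => [|j]; first by rewrite iter_sum_0r muln0.
by rewrite iter_sum_bin mul_bin_left addnS -addSn addnK dvdn_mulr.
Qed.

Lemma dvdn_iter_sum p e k r : prime p -> (0 < k < p)%N ->
  (p ^ e %| r)%N -> (p ^ e %| iter_sum k r)%N.
Proof.
case: k => // k p_prime ltkp dvdr.
have cop : coprime (p ^ e) k.+1.
  by rewrite coprimeXl // prime_coprime // gtnNdvd.
by rewrite -(Gauss_dvdr _ cop) (dvdn_trans dvdr) ?dvdn_mul_iter_sum.
Qed.

(** * The weight sequence of a tuple lambda and its periods *)

Section Weights.
Variables (F : fieldType) (n : nat) (lam : 'I_n -> F).

(* The second index is 0-based, as in [standard_form]; letting both range over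
   nat, [weight i] is 1 for [n <= i]. *)
Definition weight (i j : nat) : F :=
  \prod_(k < n | (i <= k)%N) lam k ^+ iter_sum (k - i) j.

Lemma weight_out i j : (n <= i)%N -> weight i j = 1.
Proof.
move=> leni; rewrite /weight big1 // => k leik.
by have := leq_trans (ltn_ord k) (leq_trans leni leik); rewrite ltnn.
Qed.

Lemma weightE (i : 'I_n) j :
  weight i j = lam i * \prod_(k < n | (i < k)%N) lam k ^+ iter_sum (k - i) j.
Proof.
rewrite /weight (bigD1 i) //= subnn expr1; congr (_ * _).
by apply: eq_bigl => k; rewrite ltn_neqAle andbC eq_sym.
Qed.

Lemma weight0 (i : 'I_n) : weight i 0 = lam i.
Proof.
rewrite weightE big1 ?mulr1 // => k ltik.
by rewrite -(subnSK ltik) iter_sum_0r.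
Qed.

(** Pascal's rule T_k(j+1) = T_k(j) + T_(k-1)(j+1), read in the exponents. *)
Lemma weightS i j : weight i j.+1 = weight i j * weight i.+1 j.+1.
Proof.
have -> : weight i.+1 j.+1 = \prod_(k < n | (i <= k)%N)
    (if (i < k)%N then lam k ^+ iter_sum (k - i.+1) j.+1 else 1).
  rewrite -big_mkcondr; apply: eq_bigl => k.
  by case: ltnP => [/ltnW ->|]; rewrite ?andbF.
rewrite /weight -big_split; apply: eq_bigr => k leik /=.
case: ltnP => [ltik|leki]; last first.
  by rewrite (eqP (_ : k - i == 0)%N) ?subn_eq0 //= mulr1.
by rewrite -(subnSK ltik) iter_sumS exprD.
Qed.

Definition weight_period r := forall i, weight i r = weight i 0.

Lemma weight_periodD r j i : weight_period r -> weight i (j + r) = weight i j.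
Proof.
move=> per; elim: j i => [|j IHj] i; first exact: per.
(* [weightS] keeps position j+1 in its second factor but moves to row i+1, so an inner induction
   runs downwards from row n. *)
have [m lem] := ubnP (n - i); elim: m => // m IHm in i lem *.
have [leni|ltin] := leqP n i; first by rewrite !weight_out.
rewrite addSn weightS IHj [RHS]weightS -addSn IHm //.
by rewrite -(subnSK ltin) in lem.
Qed.

Lemma weight_period_mod r j i : weight_period r ->
  weight i (j %% r) = weight i j.
Proof.
move=> per; rewrite [in RHS](divn_eq j r) addnC.
elim: (j %/ r)%N => [|c IHc]; first by rewrite addn0.
by rewrite mulSnr addnA weight_periodD.
Qed.

Lemma weight_periodP p e r : prime p -> (n <= p)%N -> (p ^ e %| r)%N ->
  (forall k : 'I_n, (0 < k)%N -> lam k ^+ (p ^ e) = 1) -> weight_period r.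
Proof.
move=> p_prime lenp dvdr lam1 i.
have [leni|ltin] := leqP n i; first by rewrite !weight_out.
rewrite (weight0 (Ordinal ltin)) (weightE (Ordinal ltin)) big1 ?mulr1 //=.
(* Only k > i remain, so every exponent T_(k-i)(r) has positive index and lambda_1 does not
   occur. *)
move=> k ltik.
have /dvdnP[c ->] : (p ^ e %| iter_sum (k - i) r)%N.
  rewrite dvdn_iter_sum // subn_gt0 ltik (leq_ltn_trans (leq_subr _ _)) //.
  exact: leq_trans (ltn_ord k) lenp.
by rewrite mulnC exprM lam1 ?expr1n // (leq_trans _ ltik).
Qed.

Hypothesis lam_neq0 : forall i, lam i != 0.

Lemma weight_neq0 i j : weight i j != 0.
Proof. by apply/prodf_neq0 => k _; rewrite expf_neq0. Qed.

(** The recursion also runs backwards: since weights are nonzero, the weight at j+1 determines the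
    one at j, down to position 0. *)
Lemma weight_eq_period j r : (forall i, weight i (j + r) = weight i j) ->
  weight_period r.
Proof.
elim: j => [//|j IHj] eqw; apply: IHj => i.
have := eqw i; rewrite addSn weightS [RHS]weightS -addSn eqw.
by move/(mulIf (weight_neq0 _ _)).
Qed.

(** The period equation of row k-1 contains lam k to the power T_1(r) = r; the later factors are
    trivial by decreasing induction on k. The hypothesis on [lam k ^+ r] lets p^e be either r itself
    or gcd(r, p^N). *)
Lemma weight_periodN p e r : prime p -> (n <= p)%N -> (p ^ e %| r)%N ->
  (forall k : 'I_n, (0 < k)%N -> lam k ^+ r = 1 -> lam k ^+ (p ^ e) = 1) ->
  weight_period r -> forall k : 'I_n, (0 < k)%N -> lam k ^+ (p ^ e) = 1.
Proof.
move=> p_prime lenp dvdr ordr per k.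
have [m lem] := ubnP (n - k); elim: m => // m IHm in k lem * => k_gt0.
apply: ordr => //.
have ltk1 : (k.-1 < n)%N by rewrite (leq_ltn_trans (leq_pred k)).
have := per (Ordinal ltk1); rewrite weight0 weightE -[RHS]mulr1.
move/(mulfI (lam_neq0 _)); rewrite (bigD1 k) /= ?prednK //.
have -> : (k - k.-1 = 1)%N by rewrite -[X in (X - _)%N](prednK k_gt0) subSnn.
rewrite iter_sum1n big1 ?mulr1 // => l /andP[ltkl nelk].
have ltl : (k < l)%N by rewrite ltn_neqAle ltkl eq_sym nelk.
have /dvdnP[c ->] : (p ^ e %| iter_sum (l - k.-1) r)%N.
  rewrite dvdn_iter_sum // subn_gt0 prednK // ltkl.
  rewrite (leq_ltn_trans (leq_subr _ _)) //.
  exact: leq_trans (ltn_ord l) lenp.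
rewrite mulnC exprM IHm ?expr1n ?(ltn_trans k_gt0) //.
by rewrite -ltnS (leq_trans _ lem) // ltnS ltn_sub2l.
Qed.

End Weights.

(** * Action on basis vectors, and intertwiners checked on generators *)

Lemma iter_ordS d q (j : 'I_d) : iter q (@ordS d) j = ((j + q) %% d)%N :> nat.
Proof.
elim: q => [|q IHq]; first by rewrite addn0 modn_small.
by rewrite /= IHq -addn1 modnDml addn1 addnS.
Qed.

Lemma mulmx_delta (F : fieldType) d (A : 'M[F]_d) (j i : 'I_d) :
  (A *m delta_mx j 0 : 'cV_d) i 0 = A i j.
Proof. by rewrite -colE mxE. Qed.

Lemma diag_mul_delta (F : fieldType) d (A : 'M[F]_d) j :
  is_diag_mx A -> A *m delta_mx j 0 = A j j *: delta_mx j 0 :> 'cV_d.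
Proof.
move/is_diag_mxP => diagA; apply/colP => i; rewrite mulmx_delta !mxE andbT.
by case: eqVneq => [->|neij]; rewrite ?mulr1 // mulr0 diagA.
Qed.

Lemma eq_mul_delta (F : fieldType) d (A B : 'M[F]_d) :
  (forall j, A *m delta_mx j 0 = B *m delta_mx j 0 :> 'cV_d) -> A = B.
Proof.
by move=> eqAB; apply/matrixP => i j; rewrite -!mulmx_delta eqAB.
Qed.

Lemma cvec_sum_delta (F : fieldType) d (v : 'cV[F]_d) :
  v = \sum_j v j 0 *: delta_mx j 0.
Proof.
by rewrite [LHS]matrix_sum_delta; apply: eq_bigr => j _; rewrite big_ord1.
Qed.

Lemma repr_comm_gen (n d : nat) (F : fieldType)
    (rho : representation (M n) F d) (A : 'M[F]_d) :
  (forall i, rho (M_a i) *m A = A *m rho (M_a i)) ->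
  rho (M_b n) *m A = A *m rho (M_b n) ->
  forall g, rho g *m A = A *m rho g.
Proof.
move=> commA commB.
have commV g : rho g *m A = A *m rho g ->
    rho (g^-1)%g *m A = A *m rho (g^-1)%g.
  move=> commg; have Vg : rho (g^-1)%g *m rho g = 1%:M.
    by rewrite -repr_mxM mulVg repr_mx1.
  have gV : rho g *m rho (g^-1)%g = 1%:M by rewrite -repr_mxM mulgV repr_mx1.
  rewrite -[LHS]mulmx1 -gV mulmxA -[_ *m A *m _]mulmxA -commg.
  by rewrite mulmxA Vg mul1mx.
move=> g; have [u ->] := word_class_surj g.
elim: u => [|[x e] u IHu].
  by rewrite repr_mx1 mul1mx mulmx1.
rewrite -cat1s word_class_cat repr_mxM -mulmxA IHu !mulmxA; congr (_ *m _).
have commx : rho (presented_gen (@M_rel n) x) *m A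
    = A *m rho (presented_gen (@M_rel n) x) by case: x.
case: e => //; rewrite -[[:: _]]/(inv_word (gen_word x)) word_class_inv.
exact: commV.
Qed.

(** * Periods and invariant subspaces in standard form *)

Section StandardForm.
Variables (n d : nat) (F : fieldType) (rho : representation (M n) F d).
Variable lam : 'I_n -> F.
Hypotheses (d_gt0 : (0 < d)%N) (rho_std : standard_form rho lam).

Local Notation w := (weight lam).
Local Notation e_ j := (delta_mx j 0 : 'cV[F]_d).

Lemma std_a i j : rho (M_a i) *m e_ j = w i j *: e_ j.
Proof.
by case: rho_std => _ diag_a _ _ entry_a; rewrite diag_mul_delta // entry_a.
Qed.

Lemma std_b j : rho (M_b n) *m e_ j = e_ (ordS j).
Proof. by case: rho_std. Qed.

Lemma std_bX q j : rho (M_b n ^+ q)%g *m e_ j = e_ (iter q (@ordS d) j).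
Proof.
elim: q => [|q IHq]; first by rewrite repr_mx1 mul1mx.
by rewrite expgS repr_mxM -mulmxA IHq std_b.
Qed.

Lemma scale_delta_mx_inj (a b : F) j : a *: e_ j = b *: e_ j -> a = b.
Proof. by move/colP/(_ j); rewrite !mxE !eqxx !mulr1. Qed.

Lemma std_lam_neq0 i : lam i != 0.
Proof.
rewrite -weight0; pose j := Ordinal d_gt0; apply/eqP => w0.
have : rho (M_a i) *m e_ j = 0 by rewrite std_a [w _ _]w0 scale0r.
move/(congr1 (mulmx (rho (M_a i)^-1%g))).
rewrite mulmxA -repr_mxM mulVg repr_mx1 mul1mx mulmx0 => /colP/(_ j).
by rewrite !mxE !eqxx => /eqP; rewrite oner_eq0.
Qed.

(** Both sides of x_i y = x_(i+1) y x_i are evaluated on e_j. Beyond [weightS], this covers the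
    wrap-around from the last position to the first. *)
Lemma std_weight_ordS i (j : 'I_d) : w i (ordS j) = w i j * w i.+1 (ordS j).
Proof.
have [leni|ltin] := leqP n i.
  by rewrite !weight_out ?mulr1 // (leq_trans leni).
pose i' := Ordinal ltin.
have comm_mul (g : M n) : (M_a i' * M_b n * (M_a i')^-1 * (M_b n)^-1)%g = g ->
    rho (M_a i') *m rho (M_b n) = rho g *m (rho (M_b n) *m rho (M_a i')).
  by move=> <-; rewrite -!repr_mxM !mulgA mulgVK mulgVK.
have [ltSi|leSi] := ltnP i.+1 n.
  have := comm_mul _ (@M_a_b_next n i' (Ordinal ltSi) erefl).
  move/(congr1 (fun A => A *m e_ j)).
  rewrite -!mulmxA std_b !std_a linearZ /= std_b linearZ /= std_a scalerA.
  exact: scale_delta_mx_inj.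
have lastSi : i.+1 = n by apply/anti_leq; rewrite ltin leSi.
have := comm_mul _ (@M_a_b_last n i' lastSi).
move/(congr1 (fun A => A *m e_ j)).
rewrite repr_mx1 mul1mx -!mulmxA std_b !std_a linearZ /= std_b.
by rewrite [w i.+1 _]weight_out // mulr1; exact: scale_delta_mx_inj.
Qed.

Lemma std_weight_period : weight_period lam d.
Proof.
move=> i; have [m lem] := ubnP (n - i); elim: m => // m IHm in i lem *.
have [leni|ltin] := leqP n i; first by rewrite !weight_out.
have ltd : (d.-1 < d)%N by rewrite prednK.
(* The wrap-around relation yields w i 0 from position d-1 exactly as [weightS] yields w i d. *)
have := std_weight_ordS i (Ordinal ltd); rewrite /= prednK // modnn => ->.
rewrite -{1}(prednK d_gt0) weightS prednK // IHm //.
by rewrite -(subnSK ltin) in lem.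
Qed.

Lemma std_distinct_irreducible :
  (forall r, (0 < r < d)%N -> ~ weight_period lam r) -> irreducible_repr rho.
Proof.
move=> noper; split=> // U Ust.
(* If all x_i agreed on e_j and e_l, the distance |l - j| < d would be a period. *)
have sep (j l : 'I_d) : j != l -> exists i : 'I_n, w i j != w i l.
  wlog ltjl : j l / (j < l)%N.
    move=> IH nejl; case: (ltngtP j l) => [ltjl|ltlj|/val_inj eqjl].
    - exact: IH.
    - by have [|i] := IH _ _ ltlj; [rewrite eq_sym | exists i; rewrite eq_sym].
    - by rewrite eqjl eqxx in nejl.
  move=> _; case: (pickP (fun i : 'I_n => w i j != w i l)) => [i|eqw].
    by exists i.
  have r_int : (0 < l - j < d)%N.
    by rewrite subn_gt0 ltjl (leq_ltn_trans (leq_subr _ _)).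
  case: (noper _ r_int); apply: (weight_eq_period std_lam_neq0 (j := j)) => i.
  rewrite subnKC; last exact: ltnW.
  have [leni|ltin] := leqP n i; first by rewrite !weight_out.
  by have /negbFE/eqP := eqw (Ordinal ltin).
have [->|Unz] := eqVneq U 0%VS; [by left | right].
pose v := vpick U; have vU : v \in U := memv_pick U.
have [j vj] : exists j, v j 0 != 0.
  apply/existsP; rewrite -negb_forall; apply: contra Unz => /forallP v0.
  by rewrite -vpick0; apply/eqP/colP => j; rewrite mxE; exact/eqP.
(* Applying x_i - w i l, with i separating j from l, kills coordinate l, keeps coordinate j nonzero
   and preserves the zeros already obtained. *)
have proj (s : seq 'I_d) : j \notin s ->
    exists2 u, u \in U & u j 0 != 0 /\ {in s, forall l, u l 0 = 0}.
  elim: s => [|l s IHs]; first by exists v.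
  rewrite inE negb_or => /andP[nejl /IHs[u uU [uj us]]].
  have [i neqw] := sep _ _ nejl.
  have entry k : (rho (M_a i) *m u - w i l *: u) k 0 = (w i k - w i l) * u k 0.
    rewrite [in rho _ *m u](cvec_sum_delta u) mulmx_sumr !mxE mulrBl.
    congr (_ - _); rewrite summxE (bigD1 k) //= linearZ /= std_a !mxE !eqxx.
    rewrite mulr1 big1 ?addr0 1?mulrC // => m nemk.
    by rewrite linearZ /= std_a !mxE eq_sym (negPf nemk) !mulr0.
  exists (rho (M_a i) *m u - w i l *: u); first by rewrite rpredB ?rpredZ ?Ust.
  split; first by rewrite entry mulf_neq0 ?subr_eq0.
  move=> k; rewrite inE entry => /predU1P[->|/us ->]; last by rewrite mulr0.
  by rewrite subrr mul0r.
have [|u uU [uj u0]] := proj [seq l <- enum 'I_d | l != j].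
  by rewrite mem_filter eqxx.
have ejU : e_ j \in U.
  rewrite -(scalerK uj (e_ j)) rpredZ //.
  suff <- : u = u j 0 *: e_ j by [].
  rewrite [LHS]cvec_sum_delta (bigD1 j) //= big1 ?addr0 // => l nelj.
  by rewrite u0 ?scale0r // mem_filter nelj mem_enum.
apply/eqP; rewrite eqEsubv subvf; apply/subvP => x _.
rewrite (cvec_sum_delta x) rpred_sum // => l _; rewrite rpredZ //.
(* Adding d keeps the exponent l - j nonnegative without changing it modulo d. *)
suff -> : l = iter (l + (d - j)) (@ordS d) j by rewrite -std_bX Ust.
apply: val_inj; rewrite /= iter_ordS addnCA subnKC; last exact: ltnW.
by rewrite modnDr modn_small.
Qed.

Lemma std_irreducible_no_period r :
  (0 < r < d)%N -> weight_period lam r -> ~ irreducible_repr rho.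
Proof.
move=> /andP[r_gt0 ltrd] per [_ irr].
pose A := rho (M_b n ^+ r)%g.
have commA : forall g, rho g *m A = A *m rho g.
  apply: repr_comm_gen => [i|]; last by rewrite -!repr_mxM -expgS -expgSr.
  apply: eq_mul_delta => j.
  rewrite -!mulmxA std_bX !std_a linearZ /= std_bX iter_ordS; congr (_ *: _).
  (* Period d removes the reduction modulo d of the index; period r then removes the shift. *)
  by rewrite (weight_period_mod _ _ std_weight_period) weight_periodD.
(* The fixed space of y^r is invariant. It contains the sum of all e_j but not the first basis
   vector, which y^r moves because 0 < r < d. *)
pose U := lker (linfun (mulmx (A - 1%:M) : 'cV[F]_d -> 'cV[F]_d)).
have memU v : (v \in U) = (A *m v == v).
  by rewrite memv_ker lfunE /= mulmxBl mul1mx subr_eq0.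
pose j0 := Ordinal d_gt0.
case: (irr U) => [g v|U0|Ufull].
- by rewrite !memU mulmxA -commA -mulmxA => /eqP ->.
- have : \sum_j e_ j \in U.
    rewrite memU mulmx_sumr; apply/eqP.
    have iter_inj : injective (iter r (@ordS d)).
      by elim: (r) => [|q IHq] x y //= /ordS_inj/IHq.
    rewrite [RHS](reindex_inj iter_inj).
    by apply: eq_bigr => j _; rewrite std_bX.
  rewrite U0 memv0 => /eqP/colP/(_ j0); rewrite summxE (bigD1 j0) //= big1.
    by rewrite !mxE addr0 => /eqP; rewrite oner_eq0.
  by move=> j nej; rewrite mxE eq_sym (negPf nej).
- have : e_ j0 \in U by rewrite Ufull memvf.
  rewrite memU std_bX => /eqP/colP/(_ j0); rewrite !mxE !eqxx andbT.
  rewrite -val_eqE /= iter_ordS add0n modn_small // eq_sym.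
  by rewrite (gtn_eqF r_gt0) => /eqP; rewrite eq_sym oner_eq0.
Qed.

End StandardForm.

(** * Depths of the lambda_i against proper periods *)

Theorem proposition8p2 (R : realType) (n p N : nat)
    (rho : representation (M n) R[i]%C (p ^ N)) (lam : 'I_n -> R[i]%C)
    (n_ge2 : (2 <= n)%N) (p_prime : prime p) (p_ge_n : (n <= p)%N)
    (rho_std : standard_form rho lam) :
  irreducible_repr rho <->
  exists i : 'I_n, (1 <= i)%N /\ has_depth p (lam i) N.
Proof.
have d_gt0 : (0 < p ^ N)%N by rewrite expn_gt0 prime_gt0.
have lam_neq0 := std_lam_neq0 d_gt0 rho_std.
have lam_pN : forall k : 'I_n, (0 < k)%N -> lam k ^+ (p ^ N) = 1.
  apply: (weight_periodN lam_neq0 p_prime p_ge_n (dvdnn _)) => //.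
  exact: std_weight_period rho_std.
split=> [irr|[i [i_gt0 [_ depth]]]]; last first.
  apply: (std_distinct_irreducible d_gt0 rho_std).
  move=> r /andP[r_gt0 ltr] per.
  have /(dvdn_pfactor _ _ p_prime)[e leeN gcdE] := dvdn_gcdr r (p ^ N).
  have lam_pe : lam i ^+ (p ^ e) = 1.
    apply: (weight_periodN lam_neq0 p_prime p_ge_n (r := r)) => //.
      by rewrite -gcdE dvdn_gcdl.
    move=> k k_gt0 lam_r; apply/eqP; rewrite -gcdE.
    (* Bezout makes gcd(r, p^N) + a p^N a multiple of r, so lam k has trivial gcd-th power. *)
    have [a _ /dvdnP[c eq_ac]] := Bezoutl (p ^ N) r_gt0.
    have : lam k ^+ (gcdn r (p ^ N) + a * p ^ N) == 1.
      by rewrite eq_ac mulnC exprM lam_r expr1n.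
    by rewrite exprD [(a * _)%N]mulnC exprM lam_pN // expr1n mulr1.
  have lteN : (e < N)%N.
    rewrite -(ltn_exp2l _ _ (prime_gt1 p_prime)) -gcdE.
    by rewrite (leq_ltn_trans _ ltr) // dvdn_leq ?dvdn_gcdl.
  have := depth N.-1; rewrite (ltn_predK lteN) => /(_ erefl).
  have leeN' : (e <= N.-1)%N by rewrite -ltnS (ltn_predK lteN).
  by rewrite /ppower_root -(subnKC leeN') expnD exprM lam_pe expr1n eqxx.
(* The disjunct N = 0 reflects that depth 0 has no lower bound to check; then any i >= 2 will do. *)
case: (pickP (fun i : 'I_n =>
    (0 < i)%N && ((N == 0%N) || ~~ ppower_root p N.-1 (lam i)))).
  move=> i /andP[i_gt0 depth]; exists i; split=> //; split.
    by rewrite /ppower_root lam_pN.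
  by move=> k Nk; move: depth; rewrite Nk.
move=> nodepth; case: (posnP N) => [N0|N_gt0].
  by have := nodepth (Ordinal n_ge2); rewrite N0.
(* When no depth equals N, all lambda_i with i >= 2 are p^(N-1)-th roots of unity, making p^(N-1) a
   proper period. *)
case: (std_irreducible_no_period d_gt0 rho_std (r := p ^ N.-1)) => //.
  by rewrite expn_gt0 prime_gt0 // ltn_exp2l ?prime_gt1 // ltn_predL.
apply: (weight_periodP p_prime p_ge_n (dvdnn _)) => k k_gt0; apply/eqP.
by have := nodepth k; rewrite k_gt0 gtn_eqF //= => /negbFE.
Qed.
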